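(* Let $s\in(0,1)$, $a=1-2s$, and let $F:\mathbb{R}\to\mathbb{R}$ be a smooth even function such that $F(1)=F(-1)=0<F(u)$ for all $-1<u<1$, $F'(1)=F'(-1)=0$, $F$ is nondecreasing in $(-1,0)$ and nonincreasing in $(0,1)$. There exist $T_1>1$ and a constant $C>0$ independent of $T$ such that the following holds for every $T>T_1$. Let $u_T$ be an odd $T$-periodic solution of $(-\partial_{xx})^su+F'(u)=0$ in $\mathbb{R}$ with $u_T(x)\in(0,1)$ for $x\in(0,\frac T2)$, whose $s$-harmonic extension $U_T$, restricted to $\Omega_T$, is a minimizer of $J(\cdot,\Omega_T)$ in $\Lambda_T$. Then $$J(U_T,\Omega_T)\le\begin{cases}C\,T^{1-2s},& s\in(0,\frac12),\\ C\ln T,& s=\frac12,\\ C,& s\in(\frac12,1).\end{cases}$$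
   Context: $(-\partial_{xx})^s$ is the fractional Laplacian (Fourier multiplier with symbol $|\xi|^{2s}$) and $d_s:=2^{2s-1}\frac{\Gamma(s)}{\Gamma(1-s)}$. The $s$-harmonic extension of $u$ is $U(x,y)=\int_{\mathbb{R}}p_s(x-z,y)u(z)dz$, $y>0$, $U(x,0)=u(x)$, where $p_s(x,y)=C_{1,s}\frac{y^{2s}}{(x^2+y^2)^{(1+2s)/2}}$ and $C_{1,s}$ is such that $\int_{\mathbb{R}}p_s(x,y)dx=1$. Set $\Omega_T:=[0,\frac T2]\times[0,+\infty)$, $H^1(\Omega_T,y^a):=\{U: y^a(U^2+|\nabla U|^2)\in L^1(\Omega_T)\}$, $$J(U,\Omega_T):=\frac{d_s}{2}\int_{\Omega_T}y^a|\nabla U(x,y)|^2dx\,dy+\int_0^{T/2}F(U(x,0))dx,$$ $$\Lambda_T:=\{U\in H^1(\Omega_T,y^a):\ U\ge0,\ U(0,y)=0=U(\tfrac T2,y)\ \ \forall y\ge0\}.$$ It is known that for all sufficiently large $T$ the equation admits an odd $T$-periodic solution $u_T$ with the properties required in the claim (obtained as such a nontrivial minimizer). *)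

(* Defs.v *)
From HB Require Import structures.
From mathcomp Require Import all_boot all_order all_algebra.
From mathcomp Require Import all_classical all_reals all_analysis.
Set Implicit Arguments.
Unset Strict Implicit.
Unset Printing Implicit Defensive.
Import Order.TTheory GRing.Theory Num.Theory.
Import numFieldNormedType.Exports.
Local Open Scope classical_set_scope.
Local Open Scope ring_scope.

Section Definitions.
Context {R : realType}.
Implicit Types (s T x y c : R) (F u : R -> R) (U V : R * R -> R).

Notation mu := (@lebesgue_measure R).
Notation mu2 := (mu \x mu)%E.

Definition smooth (f : R -> R) : Prop :=
  forall (n : nat) (x : R), derivable (f^`(n))%classic x 1.

Definition test_function (phi : R -> R) : Prop :=
  smooth phi /\ compact (closure [set x | phi x != 0]).

(* The imaginary part of the Fourier inversion integral
   (2 pi)^-1 * \int |xi|^(2s) (\int phi z e^(i xi (x - z)) dz) dxi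
   vanishes, since phi is real and the symbol is even. *)
Definition fracLaplace s (phi : R -> R) (x : R) : R :=
  (2 * pi)^-1 * \int[mu]_(xi in setT)
    (`|xi| `^ (2 * s) * \int[mu]_(z in setT) (phi z * cos (xi * (x - z)))).

(* (-d_xx)^s u = f on the real line, in the sense of distributions: the
   (symmetric) multiplier is extended by duality to functions u that need not
   decay at infinity, such as periodic ones. *)
Definition fracLaplace_eq s (u f : R -> R) : Prop :=
  forall phi, test_function phi ->
    (\int[mu]_(x in setT) (u x * fracLaplace s phi x)) =
    (\int[mu]_(x in setT) (f x * phi x)).

Definition Gamma x : R :=
  \int[mu]_(t in `]0, +oo[%classic) (t `^ (x - 1) * expR (- t)).

Definition dconst s : R := 2 `^ (2 * s - 1) * (Gamma s / Gamma (1 - s)).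

Definition poisson_profile s (x y : R) : R :=
  y `^ (2 * s) / (x ^+ 2 + y ^+ 2) `^ ((1 + 2 * s) / 2).

Definition Cconst s : R :=
  get [set c | forall y, 0 < y ->
    ((\int[mu]_(x in setT) (c * poisson_profile s x y)%:E) = 1)%E].

Definition poisson s (x y : R) : R := Cconst s * poisson_profile s x y.

Definition harmonic_extension s u (p : R * R) : R :=
  if 0 < p.2 then \int[mu]_(z in setT) (poisson s (p.1 - z) p.2 * u z)
  else u p.1.

Definition Omega T : set (R * R) := [set p | 0 <= p.1 <= T / 2 /\ 0 <= p.2].

Definition Omega_int T : set (R * R) := [set p | 0 < p.1 < T / 2 /\ 0 < p.2].

Definition e1 : R * R := (1, 0).
Definition e2 : R * R := (0, 1).

Fixpoint Ck (n : nat) (phi : R * R -> R) : Prop :=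
  continuous phi /\
  if n is m.+1 then
    [/\ forall p, derivable phi p e1, forall p, derivable phi p e2,
        Ck m ('D_e1 phi) & Ck m ('D_e2 phi)]
  else True.

Definition test_function2 (O : set (R * R)) (phi : R * R -> R) : Prop :=
  [/\ forall n, Ck n phi,
      compact (closure [set p | phi p != 0]) &
      closure [set p | phi p != 0] `<=` O].

Definition locally_L1 (O : set (R * R)) (f : R * R -> R) : Prop :=
  forall K, compact K -> K `<=` O -> mu2.-integrable K (fun p => (f p)%:E).

Definition is_weak_gradient T U (G : R * R -> R * R) : Prop :=
  [/\ measurable_fun (Omega T) G,
      [/\ locally_L1 (Omega_int T) U, locally_L1 (Omega_int T) (fst \o G) &
          locally_L1 (Omega_int T) (snd \o G)] &
      forall phi, test_function2 (Omega_int T) phi ->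
        (\int[mu2]_(p in Omega T) (U p * 'D_e1 phi p)) =
          - (\int[mu2]_(p in Omega T) ((G p).1 * phi p)) /\
        (\int[mu2]_(p in Omega T) (U p * 'D_e2 phi p)) =
          - (\int[mu2]_(p in Omega T) ((G p).2 * phi p))].

Definition weight s (p : R * R) : R := p.2 `^ (1 - 2 * s).

Definition normsq (v : R * R) : R := v.1 ^+ 2 + v.2 ^+ 2.

Definition weighted_H1 s T U : Prop :=
  measurable_fun (Omega T) U /\
  exists2 G, is_weak_gradient T U G &
    mu2.-integrable (Omega T)
      (fun p => (weight s p * (U p ^+ 2 + normsq (G p)))%:E).

(* The values of U on the boundary of Omega T are its traces: they are the
   limits of U along almost every line orthogonal to the boundary.  Each class
   of weighted_H1 has a representative, absolutely continuous on almost every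
   such line, for which these limits exist; they depend on the class only. *)
Definition has_traces T U : Prop :=
  [/\ {ae mu, forall x, 0 < x < T / 2 -> U (x, y) @[y --> 0^'+] --> U (x, 0)},
      {ae mu, forall y, 0 < y -> U (x, y) @[x --> 0^'+] --> U (0, y)} &
      {ae mu, forall y, 0 < y ->
        U (x, y) @[x --> (T / 2)^'-] --> U (T / 2, y)}].

Definition Lambda s T : set (R * R -> R) :=
  [set U | [/\ weighted_H1 s T U, has_traces T U,
      forall p, Omega T p -> 0 <= U p &
      forall y, 0 <= y -> U (0, y) = 0 /\ U (T / 2, y) = 0]].

(* Weak gradients agree almost everywhere, so that for U in weighted_H1 the
   infimum is taken over a single value; it is +oo if U has no weak gradient. *)
Definition dirichlet s T U : \bar R :=
  ereal_inf [set (\int[mu2]_(p in Omega T) (weight s p * normsq (G p))%:E)%E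
            | G in is_weak_gradient T U].

Definition J s F T U : \bar R :=
  ((dconst s / 2)%:E * dirichlet s T U
   + (\int[mu]_(x in `[0%R, (T / 2)%R]%classic) (F (U (x, 0%R)))%:E))%E.

(* F is arbitrary outside [-1, 1], so F(V(., 0)) may fail to be integrable for
   some V in Lambda s T; J is compared only where its potential term is an
   absolutely convergent integral. *)
Definition potential_integrable F T V : Prop :=
  mu.-integrable `[0, (T / 2)]%classic (fun x => (F (V (x, 0)))%:E).

Definition is_minimizer s F T U : Prop :=
  [/\ Lambda s T U, potential_integrable F T U &
      forall V, Lambda s T V -> potential_integrable F T V ->
        (J s F T U <= J s F T V)%E].

Definition double_well F : Prop :=
  [/\ smooth F /\ (forall x, F (- x) = F x),
      [/\ F 1 = 0, F (-1) = 0 & forall x, -1 < x < 1 -> 0 < F x],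
      (F^`())%classic 1 = 0 /\ (F^`())%classic (-1) = 0,
      forall x y, -1 < x -> x <= y -> y < 0 -> F x <= F y &
      forall x y, 0 < x -> x <= y -> y < 1 -> F y <= F x].

(* No integrability is required of u: it is bounded, being odd and T-periodic
   with values in (0, 1) on (0, T/2). *)
Definition odd_periodic_solution s F T u : Prop :=
  [/\ measurable_fun setT u,
      (forall x, u (- x) = - u x) /\ periodic u T,
      forall x, 0 < x < T / 2 -> 0 < u x < 1 &
      fracLaplace_eq s u (fun x => - (F^`())%classic (u x))].

End Definitions.

(* Main.v *)
Require Import Defs.
From HB Require Import structures.
From mathcomp Require Import all_boot all_order all_algebra.
From mathcomp Require Import all_classical all_reals all_analysis.
From mathcomp Require Import measurable_realfun.
From mathcomp Require Import ring lra.
Set Implicit Arguments.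
Unset Strict Implicit.
Unset Printing Implicit Defensive.
Import Order.TTheory GRing.Theory Num.Theory.
Import numFieldNormedType.Exports.
Local Open Scope classical_set_scope.
Local Open Scope ring_scope.

(** The extension of the solution minimizes J among the admissible functions,
    so its energy is at most that of any explicit admissible function, and one
    with energy of the stated size is enough.  With L = T / 2 and
    q(x) = x (L - x), take

      V(x, y) = q(x)^2 / (q(x)^2 + L^2 (1 + y^2)).

    It is rational and smooth on the whole plane, since its denominator D is
    positive; it vanishes for x = 0 and x = L, and its trace on y = 0 is close
    to 1 away from both ends.  One function controls everything: with
    E = L^2 / D,

      1 - V(x, 0) = E(x, 0),   |grad V|^2 <= 2 E,   V^2 <= L^2 E

    on the half-strip ([sub1_competitor_trace], [competitor_normsq_le],
    [competitor_sqr_le]).  As q(x) >= L x / 2 on the left half of [0, L], E is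
    at most 3 / (1 + y + x / 2)^2 plus its mirror image, so that
    ([integral_envelope_slice])

      int_0^L E(x, y) dx <= 6 L / ((1 + y) (1 + y + L / 2)),

    which is at most 12 for y <= 1, 12 / y for y <= L and 6 L / y^2 beyond.
    Multiplying by y^(1 - 2 s) and integrating each piece
    ([weighted_envelope_le]) gives a bounded contribution from y <= 1, one of
    order L^(1 - 2 s) from y >= L, and the integral of y^(- 2 s) over [1, L]
    in between, which is where the three regimes of the theorem come from.

    For the potential, F(1) = 0 and F is Lipschitz on [0, 1], hence
    F(V(x, 0)) <= K (1 - V(x, 0)) = K E(x, 0), and the slice bound at y = 0
    bounds the integral by 12 K, whatever T is.

    That V has finite weighted Dirichlet energy in the sense of weak gradients
    is the integration by parts of [is_weak_gradient_C1], which reduces by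
    Fubini to the fundamental theorem of calculus on lines. *)

(** * Measurability and integrability of continuous functions on the plane *)

Section PlaneMeasure.
Context {R : realType}.
Notation mu := (@lebesgue_measure R).
Notation mu2 := (mu \x mu)%E.

(** The sigma-algebra of the plane is the product of the Borel ones of the
    line, so openness has to be related to it by hand: an open set is the union
    of the countably many rational boxes that it contains. *)
Lemma open_measurable_plane (U : set (R * R)) : open U -> measurable U.
Proof.
move=> oU.
pose box (r : rat * rat * (rat * rat)) : set (R * R) :=
  `]ratr r.1.1, ratr r.1.2[ `*` `]ratr r.2.1, ratr r.2.2[.
have -> : U = \bigcup_r (if `[<box r `<=` U>] then box r else set0).
  apply/seteqP; split => [[x y] Uxy|p [r _]]; last by case: asboolP => // /[apply].
  have /nbhs_ballP[e /= e0 beU] : nbhs (x, y) U by exact: open_nbhs_nbhs.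
  have [a /[!in_itv]/= /andP[ea ax]] := @rat_in_itvoo R (x - e) x ltac:(lra).
  have [b /[!in_itv]/= /andP[xb be]] := @rat_in_itvoo R x (x + e) ltac:(lra).
  have [c /[!in_itv]/= /andP[ec cy]] := @rat_in_itvoo R (y - e) y ltac:(lra).
  have [d /[!in_itv]/= /andP[yd de]] := @rat_in_itvoo R y (y + e) ltac:(lra).
  exists (a, b, (c, d)) => //=.
  rewrite asboolT.
    by split; rewrite /= in_itv/= ?ax ?xb ?cy ?yd.
  move=> [x' y'] [] /=; rewrite !in_itv/= => /andP[ax' xb'] /andP[cy' yd'].
  apply: beU; split; rewrite /= /ball/= ltr_norml; apply/andP; split; lra.
apply: countable_bigcupT_measurable => // r.
by case: asboolP => // _; exact: measurableX.
Qed.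

Lemma continuous_measurable_plane (f : R * R -> R) :
  continuous f -> measurable_fun setT f.
Proof.
move=> /continuousP cf; apply: (measurability _ (RGenOpens.measurableE R)).
move=> _ [_ [a [b ->] <-]]; rewrite setTI; apply: open_measurable_plane.
exact/cf/interval_open.
Qed.

Lemma compact_measurable_plane (K : set (R * R)) : compact K -> measurable K.
Proof.
move=> cK; rewrite -[K]setCK; apply: measurableC.
apply: open_measurable_plane; apply: closed_openC.
by apply: compact_closed => //; exact: (@norm_hausdorff R (R * R)%type).
Qed.

Lemma compact_box (K : set (R * R)) : compact K ->
  exists2 M : R, 0 < M & forall p, K p -> `|p.1| <= M /\ `|p.2| <= M.
Proof.
move=> /compact_bounded[M [_ KM]]; exists (`|M| + 1) => [|p Kp].
  by rewrite ltr_pwDr.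
have : `|p| <= `|M| + 1.
  by apply: KM => //; rewrite (le_lt_trans (ler_norm M))// ltrDl.
by rewrite prod_normE/= ge_max => /andP[].
Qed.

Lemma compact_finite_measure_plane (K : set (R * R)) :
  compact K -> (mu2 K < +oo)%E.
Proof.
move=> cK; have [M M0 KM] := compact_box cK.
have KB : K `<=` `[- M, M] `*` `[- M, M].
  by move=> p /KM[p1 p2]; split; rewrite /= in_itv/= -ler_norml.
have mKB : (mu2 K <= mu2 (`[(- M)%R, M] `*` `[(- M)%R, M]))%E.
  apply: le_measure => //; rewrite inE.
    exact: compact_measurable_plane.
  exact: measurableX.
apply: (le_lt_trans mKB).
rewrite product_measure1E//= lebesgue_measure_itv/=.
by case: ifP => _; rewrite -?EFinD -?EFinM ?mule0 ltry.
Qed.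

Lemma continuous_locally_L1 (O : set (R * R)) (f : R * R -> R) :
  continuous f -> locally_L1 O f.
Proof.
move=> cf K cK _.
apply: (@measurable_bounded_integrable _ _ _ mu2 f K).
- exact: compact_measurable_plane.
- exact: compact_finite_measure_plane.
- by apply: measurable_funTS; exact: continuous_measurable_plane.
- have /compact_bounded[M [Mr fM]] : compact (f @` K).
    by apply: continuous_compact => //; exact: continuous_subspaceT.
  by exists M; split=> // x Mx p Kp; apply: (fM _ Mx); exists p.
Qed.

End PlaneMeasure.

(** * A classical gradient is a weak gradient *)

Section WeakGradient.
Context {R : realType}.
Notation mu := (@lebesgue_measure R).
Notation mu2 := (mu \x mu)%E.

Lemma is_derive_continuous (g : R -> R) (x dg : R) :
  is_derive x 1 g dg -> {for x, continuous g}.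
Proof.
by move=> [+ _]; rewrite derivable1_diffP => /differentiable_continuous.
Qed.

(** The fundamental theorem of calculus in the form used below: the primitive
    is differentiable up to the end points, which gives its one-sided
    continuity there. *)
Lemma FTC_is_derive (g dg : R -> R) (a b : R) : a < b ->
  {within `[a, b], continuous dg} ->
  (forall x : R, a <= x <= b -> is_derive x 1 g (dg x)) ->
  (\int[mu]_(x in `[a, b]) (dg x)%:E = (g b - g a)%:E)%E.
Proof.
move=> ab cdg ig; rewrite EFinB; apply: continuous_FTC2 => //.
  split=> [x /[!in_itv]/= /andP[ax xb]| |].
  - by apply: (@ex_derive _ _ _ _ _ _ (dg x)); apply: ig; rewrite !ltW.
  - by apply/cvg_at_right_filter/(is_derive_continuous (ig _ _)); rewrite lexx ltW.
  - by apply/cvg_at_left_filter/(is_derive_continuous (ig _ _)); rewrite lexx ltW.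
move=> x /[!in_itv]/= /andP[ax xb]; rewrite derive1E.
by apply: derive_val; apply: ig; rewrite !ltW.
Qed.

(** Integrate over a segment whose end points lie beyond the support. *)
Lemma integral_derivative_compact_support (g dg : R -> R) (M : R) :
  continuous dg -> (forall x : R, is_derive x 1 g (dg x)) ->
  (forall x, M < `|x| -> g x = 0 /\ dg x = 0) ->
  (\int[mu]_x (dg x)%:E = 0)%E.
Proof.
move=> cdg ig g0; pose B : R := `|M| + 1.
have B0 : 0 < B by rewrite ltr_pwDr.
have MB : M < B by rewrite (le_lt_trans (ler_norm M))// ltrDl.
have -> : (\int[mu]_x (dg x)%:E = \int[mu]_(x in `[(- B)%R, B]) (dg x)%:E)%E.
  rewrite [RHS]integral_mkcond; apply: eq_integral => x _.
  rewrite patchE; case: ifPn => //; rewrite notin_setE/= in_itv/= -ler_norml.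
  by move=> /negP; rewrite -ltNge => /(lt_trans MB)/g0[_ ->].
rewrite (@FTC_is_derive g)//; first 1 last.
- by move: B0; lra.
- exact: continuous_subspaceT.
have [-> _] := g0 B ltac:(by rewrite gtr0_norm).
have [-> _] := g0 (- B) ltac:(by rewrite normrN gtr0_norm).
by rewrite subrr.
Qed.

Lemma continuous_slice1 (f : R * R -> R) (y : R) :
  continuous f -> continuous (fun t => f (t, y)).
Proof.
move=> cf x; apply: (@continuous_comp _ _ _ (fun t => (t, y)) f); last exact: cf.
exact: (cvg_pair cvg_id (cvg_cst _)).
Qed.

Lemma continuous_slice2 (f : R * R -> R) (x : R) :
  continuous f -> continuous (fun t => f (x, t)).
Proof.
move=> cf y; apply: (@continuous_comp _ _ _ (fun t => (x, t)) f); last exact: cf.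
exact: (cvg_pair (cvg_cst _) cvg_id).
Qed.

Lemma compact_support_integrable (S : set (R * R)) (f : R * R -> R) :
  compact S -> continuous f -> (forall p, ~ S p -> f p = 0) ->
  mu2.-integrable setT (EFin \o f).
Proof.
move=> cS cf f0.
have iS : mu2.-integrable S (EFin \o f).
  exact: (@continuous_locally_L1 _ setT).
have [/(_ iS) + _] :=
  @integrable_mkcond _ _ _ mu2 _ (EFin \o f) (compact_measurable_plane cS).
apply: eq_integrable => // p _; rewrite patchE; case: ifPn => //.
by rewrite notin_setE => /f0 /= ->.
Qed.

(** By Fubini, integrating first along the lines parallel to the derivative:
    each inner integral is that of the derivative of a compactly supported
    function of one variable. *)
Lemma integral_partial1_compact_support (S : set (R * R)) (g dg : R * R -> R) :
  compact S -> continuous dg ->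
  (forall p, ~ S p -> g p = 0 /\ dg p = 0) ->
  (forall x y : R, is_derive x 1 (fun t => g (t, y)) (dg (x, y))) ->
  (\int[mu2]_p (dg p)%:E = 0)%E.
Proof.
move=> cS cdg g0 ig; have [M M0 SM] := compact_box cS.
have idg : mu2.-integrable setT (EFin \o dg).
  by apply: (compact_support_integrable cS) => // p /g0[].
rewrite -[LHS](integral21_prod_meas1 idg) /fubini_G integral0_eq// => y _.
apply: (@integral_derivative_compact_support (fun t => g (t, y)) _ M) => //=.
- by move=> x; exact: (continuous_slice1 cdg).
- by move=> x Mx; apply: (g0 (x, y)) => /SM[/=]; rewrite leNgt Mx.
Qed.

Lemma integral_partial2_compact_support (S : set (R * R)) (g dg : R * R -> R) :
  compact S -> continuous dg ->
  (forall p, ~ S p -> g p = 0 /\ dg p = 0) ->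
  (forall x y : R, is_derive y 1 (fun t => g (x, t)) (dg (x, y))) ->
  (\int[mu2]_p (dg p)%:E = 0)%E.
Proof.
move=> cS cdg g0 ig; have [M M0 SM] := compact_box cS.
have idg : mu2.-integrable setT (EFin \o dg).
  by apply: (compact_support_integrable cS) => // p /g0[].
rewrite -[LHS](integral12_prod_meas1 idg) /fubini_F integral0_eq// => x _.
apply: (@integral_derivative_compact_support (fun t => g (x, t)) _ M) => //=.
- by move=> y; exact: (continuous_slice2 cdg).
- by move=> y My; apply: (g0 (x, y)) => /SM[_ /=]; rewrite leNgt My.
Qed.

(** The directional derivatives of a test function are derivatives of its
    restrictions to lines: the two difference quotients are the same function
    of the increment. *)
Lemma is_derive_slice1 (f : R * R -> R) (x y : R) :
  derivable f (x, y) e1 -> is_derive x 1 (fun t => f (t, y)) ('D_e1 f (x, y)).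
Proof.
have E : (fun h : R => h^-1 *: (f (h *: e1 + (x, y)) - f (x, y))) =
         (fun h : R => h^-1 *: (f (h *: (1 : R) + x, y) - f (x, y))).
  apply/funext => h; congr (_ *: (f _ - _)).
  by congr pair; rewrite /= scaler0 add0r.
by rewrite /derive /derivable E => df; apply: DeriveDef.
Qed.

Lemma is_derive_slice2 (f : R * R -> R) (x y : R) :
  derivable f (x, y) e2 -> is_derive y 1 (fun t => f (x, t)) ('D_e2 f (x, y)).
Proof.
have E : (fun h : R => h^-1 *: (f (h *: e2 + (x, y)) - f (x, y))) =
         (fun h : R => h^-1 *: (f (x, h *: (1 : R) + y) - f (x, y))).
  apply/funext => h; congr (_ *: (f _ - _)).
  by congr pair; rewrite /= scaler0 add0r.
by rewrite /derive /derivable E => df; apply: DeriveDef.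
Qed.

Lemma measurable_Omega (T : R) : measurable (Omega T).
Proof.
have -> : Omega T = `[0, T / 2] `*` `[0, +oo[; last exact: measurableX.
by apply/seteqP; split => p [] /=; rewrite !in_itv/= ?andbT.
Qed.

(** A test function lives in the interior of the half-strip, so its integrals
    may be taken over the plane, where no boundary term appears. *)
Lemma Rintegral_Omega_support (T : R) (S : set (R * R)) (f : R * R -> R) :
  S `<=` Omega T -> (forall p, ~ S p -> f p = 0) ->
  \int[mu2]_(p in Omega T) f p = \int[mu2]_p f p.
Proof.
move=> SO f0; rewrite /Rintegral integral_mkcond; congr fine.
apply: eq_integral => p _; rewrite patchE; case: ifPn => //.
by rewrite notin_setE => nO; rewrite f0// => /SO.
Qed.

(** For a test function phi with support S, the product V phi is of class C1
    along lines and vanishes off S, so its partial derivatives integrate to 0;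
    expanding them by the Leibniz rule is the integration by parts. *)
Lemma is_weak_gradient_C1 (T : R) (V Gx Gy : R * R -> R) :
  continuous V -> continuous Gx -> continuous Gy ->
  (forall x y : R, is_derive x 1 (fun t => V (t, y)) (Gx (x, y))) ->
  (forall x y : R, is_derive y 1 (fun t => V (x, t)) (Gy (x, y))) ->
  is_weak_gradient T V (fun p => (Gx p, Gy p)).
Proof.
move=> cV cGx cGy dx dy; split.
- apply: measurable_funTS; apply: measurable_fun_pair;
    exact: continuous_measurable_plane.
- by split; exact: continuous_locally_L1.
move=> phi [/(_ 1%N)[cphi [d1 d2 [cD1 _] [cD2 _]]] cS SO].
set S := closure _ in cS SO.
have SOT : S `<=` Omega T.
  move=> p /SO[/andP[/ltW ? /ltW ?] /ltW ?]; split => //; exact/andP.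
have phi0 p : ~ S p -> \near p, phi p = 0.
  move=> nSp; have oS : open (~` S) by exact/closed_openC/closed_closure.
  have : nbhs p (~` S) by exact: open_nbhs_nbhs.
  apply: filterS => q nSq; apply: contrapT => q0; apply: nSq.
  by apply: subset_closure; apply/eqP.
have D0 p v : ~ S p -> 'D_v phi p = 0.
  by move=> /phi0/(near_eq_derive v) ->; rewrite derive_cst.
have phi_0 p : ~ S p -> phi p = 0 by move=> /phi0/nbhs_singleton.
(* D stands for a partial derivative of phi and G for that of V. *)
have parts (D G : R * R -> R) : continuous D -> continuous G ->
    (forall p, ~ S p -> D p = 0) ->
    (\int[mu2]_p (V p * D p + G p * phi p)%:E = 0)%E ->
    \int[mu2]_(p in Omega T) (V p * D p) =
    - \int[mu2]_(p in Omega T) (G p * phi p).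
  move=> cD cG D_0 VG0; apply/eqP; rewrite -addr_eq0; apply/eqP.
  rewrite !(@Rintegral_Omega_support T S)//; first last.
  - by move=> p /D_0 ->; rewrite mulr0.
  - by move=> p /phi_0 ->; rewrite mulr0.
  rewrite -RintegralD//; first by rewrite /Rintegral VG0.
  - apply: (compact_support_integrable cS) => [p|p /D_0 ->]; last by rewrite mulr0.
    by apply: cvgM; [exact: cV|exact: cD].
  - apply: (compact_support_integrable cS) => [p|p /phi_0 ->]; last by rewrite mulr0.
    by apply: cvgM; [exact: cG|exact: cphi].
have cVG (D G : R * R -> R) : continuous D -> continuous G ->
    continuous (fun p => V p * D p + G p * phi p).
  move=> cD cG p; apply: cvgD; apply: cvgM;
    [exact: cV|exact: cD|exact: cG|exact: cphi].
split; apply: parts => //.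
- by move=> p; exact: D0.
- apply: (@integral_partial1_compact_support S (fun p => V p * phi p)) => //.
  + exact: cVG.
  + by move=> p nSp; rewrite phi_0// D0// !mulr0 addr0.
  + move=> x y; have := is_deriveM (dx x y) (is_derive_slice1 (d1 (x, y))).
    by move=> h; apply: is_derive_eq h _; rewrite /GRing.scale/= [phi _ * _]mulrC.
- by move=> p; exact: D0.
- apply: (@integral_partial2_compact_support S (fun p => V p * phi p)) => //.
  + exact: cVG.
  + by move=> p nSp; rewrite phi_0// D0// !mulr0 addr0.
  + move=> x y; have := is_deriveM (dy x y) (is_derive_slice2 (d2 (x, y))).
    by move=> h; apply: is_derive_eq h _; rewrite /GRing.scale/= [phi _ * _]mulrC.
Qed.


End WeakGradient.

(** * The competitor and its pointwise bounds *)

Section Competitor.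
Context {R : realType}.
Implicit Types (L x y : R) (p : R * R).

Lemma is_derive_div (f g : R -> R) (x df dg : R) : g x != 0 ->
  is_derive x 1 f df -> is_derive x 1 g dg ->
  is_derive x 1 (fun t => f t / g t) ((df * g x - f x * dg) / g x ^+ 2).
Proof.
move=> gx0 idf idg.
have h := is_deriveM idf (is_deriveV gx0 idg).
apply: is_derive_eq h _; rewrite /GRing.scale/=.
by field.
Qed.

Definition parabola (L x : R) : R := x * (L - x).
Definition competitor_den (L : R) (p : R * R) : R :=
  parabola L p.1 ^+ 2 + L ^+ 2 * (1 + p.2 ^+ 2).
Definition competitor (L : R) (p : R * R) : R :=
  parabola L p.1 ^+ 2 / competitor_den L p.
(** The closed forms of the two partial derivatives of [competitor]. *)
Definition competitor_dx (L : R) (p : R * R) : R :=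
  2 * parabola L p.1 * (L - 2 * p.1) * (L ^+ 2 * (1 + p.2 ^+ 2)) /
  competitor_den L p ^+ 2.
Definition competitor_dy (L : R) (p : R * R) : R :=
  - (parabola L p.1 ^+ 2 * (2 * L ^+ 2 * p.2)) / competitor_den L p ^+ 2.
(** The common majorant of the Dirichlet and potential densities. *)
Definition envelope (L : R) (p : R * R) : R := L ^+ 2 / competitor_den L p.

Lemma competitor_den_gt0 L p : 0 < L -> 0 < competitor_den L p.
Proof.
move=> L0; rewrite /competitor_den ltr_wpDl ?sqr_ge0// mulr_gt0 ?exprn_gt0//.
by rewrite ltr_pwDl// sqr_ge0.
Qed.

Lemma is_derive_parabola L x : is_derive x 1 (parabola L) (L - 2 * x).
Proof.
have h := is_deriveM (is_derive_id x 1)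
  (is_deriveB (is_derive_cst L x 1) (is_derive_id x 1)).
by apply: is_derive_eq h _; rewrite !fctE /GRing.scale/=; ring.
Qed.

Lemma is_derive_competitor_dx L x y : 0 < L ->
  is_derive x 1 (fun t => competitor L (t, y)) (competitor_dx L (x, y)).
Proof.
move=> L0; have d0 : competitor_den L (x, y) != 0.
  by rewrite gt_eqF// competitor_den_gt0.
have dA := is_deriveX 2 (is_derive_parabola L x).
have dD := is_deriveD dA (is_derive_cst (L ^+ 2 * (1 + y ^+ 2)) x 1).
have h := @is_derive_div _ (parabola L ^+ 2 + cst (L ^+ 2 * (1 + y ^+ 2)))
  x _ _ d0 dA dD.
apply: is_derive_eq h _.
rewrite !fctE /competitor_dx /= /GRing.scale/=; move: d0.
rewrite /competitor_den/= => d0.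
by field.
Qed.

Lemma is_derive_competitor_dy L x y : 0 < L ->
  is_derive y 1 (fun t => competitor L (x, t)) (competitor_dy L (x, y)).
Proof.
move=> L0; have d0 : competitor_den L (x, y) != 0.
  by rewrite gt_eqF// competitor_den_gt0.
have dA := is_derive_cst (parabola L x ^+ 2) y 1.
have dB := is_deriveM (is_derive_cst (L ^+ 2) y 1)
  (is_deriveD (is_derive_cst (1 : R) y 1) (is_deriveX 2 (is_derive_id y 1))).
have dD := is_deriveD dA dB.
have h := @is_derive_div _
  (cst (parabola L x ^+ 2) + cst (L ^+ 2) * (cst 1 + id ^+ 2)) y _ _ d0 dA dD.
apply: is_derive_eq h _.
rewrite !fctE /competitor_dy /= /GRing.scale/=; move: d0. 
rewrite /competitor_den/= => d0.
by field.
Qed.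

Lemma continuous_parabola_fst L : continuous (fun p : R * R => parabola L p.1).
Proof.
move=> p; apply: cvgM; first exact: cvg_fst.
by apply: cvgB; [exact: cvg_cst|exact: cvg_fst].
Qed.

Lemma continuous_sqr (f : R * R -> R) :
  continuous f -> continuous (fun p => f p ^+ 2).
Proof. by move=> cf p; exact: (cvgM (cf p) (cf p)). Qed.

Lemma continuous_competitor_den L : continuous (competitor_den L).
Proof.
move=> p; apply: cvgD; first exact/continuous_sqr/continuous_parabola_fst.
apply: cvgMr; apply: cvgD; first exact: cvg_cst.
by apply: (@continuous_sqr snd) => q; exact: cvg_snd.
Qed.

Lemma continuous_div_competitor_den L n (f : R * R -> R) : 0 < L ->
  continuous f -> continuous (fun p => f p / competitor_den L p ^+ n).
Proof.
move=> L0 cf p; apply: cvgM; first exact: cf.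
apply: cvgV; first by rewrite expf_neq0// gt_eqF// competitor_den_gt0.
elim: n => [|n ih]; first by under eq_fun do rewrite expr0; exact: cvg_cst.
under eq_fun do rewrite exprS.
by rewrite exprS; apply: cvgM => //; exact: continuous_competitor_den.
Qed.

Lemma continuous_competitor L : 0 < L -> continuous (competitor L).
Proof.
move=> L0; apply: (@continuous_div_competitor_den L 1) => //.
exact/continuous_sqr/continuous_parabola_fst.
Qed.

Lemma continuous_envelope L : 0 < L -> continuous (envelope L).
Proof.
move=> L0; apply: (@continuous_div_competitor_den L 1) => // p.
exact: cvg_cst.
Qed.

Lemma continuous_competitor_dx L : 0 < L -> continuous (competitor_dx L).
Proof.
move=> L0; apply: continuous_div_competitor_den => // p.
apply: cvgM.
  apply: cvgM.
    by apply: cvgMr; exact: continuous_parabola_fst.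
  by apply: cvgB; [exact: cvg_cst|apply: cvgMr; exact: cvg_fst].
apply: cvgMr; apply: cvgD; first exact: cvg_cst.
by apply: (@continuous_sqr snd) => q; exact: cvg_snd.
Qed.

Lemma continuous_competitor_dy L : 0 < L -> continuous (competitor_dy L).
Proof.
move=> L0; apply: continuous_div_competitor_den => // p; apply: cvgN; apply: cvgM.
  exact/continuous_sqr/continuous_parabola_fst.
by apply: cvgMr; exact: cvg_snd.
Qed.

(** With A = q^2, B = L^2 (1 + y^2) and D = A + B, the squares of the partial
    derivatives are 4 A B (L - 2 x)^2 B / D^4 and
    4 A (L^2 y^2) A L^2 / D^4.  Both are at most L^2 / D, because
    (L - 2 x)^2 <= L^2, L^2 y^2 <= B, A <= D, B <= D and 4 A B <= D^2. *)
Lemma competitor_normsq_le L p : 0 < L -> 0 <= p.1 <= L ->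
  normsq (competitor_dx L p, competitor_dy L p) <= 2 * envelope L p.
Proof.
move=> L0 /andP[p0 pL]; have D0 := competitor_den_gt0 p L0.
rewrite /normsq /competitor_dx /competitor_dy /envelope /=.
move: D0; rewrite /competitor_den; set q := parabola L p.1; set A := q ^+ 2.
set B := L ^+ 2 * (1 + p.2 ^+ 2) => D0.
have A0 : 0 <= A by rewrite sqr_ge0.
have B0 : 0 <= B by rewrite mulr_ge0 ?sqr_ge0// addr_ge0// sqr_ge0.
have AB0 : 0 <= 4 * (A * B) by rewrite mulr_ge0// mulr_ge0.
have y0 : 0 <= L ^+ 2 * p.2 ^+ 2 by rewrite mulr_ge0 ?sqr_ge0.
have e2 : (L - 2 * p.1) ^+ 2 <= L ^+ 2 by nra.
have AB : 4 * (A * B) <= (A + B) ^+ 2 by have := sqr_ge0 (A - B); nra.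
have yB : L ^+ 2 * p.2 ^+ 2 <= B by rewrite /B; have := sqr_ge0 L; nra.
have dx : (2 * q * (L - 2 * p.1) * B / (A + B) ^+ 2) ^+ 2 <= L ^+ 2 / (A + B).
  have -> : (2 * q * (L - 2 * p.1) * B / (A + B) ^+ 2) ^+ 2 =
            (4 * (A * B)) * B * (L - 2 * p.1) ^+ 2 / (A + B) ^+ 4.
    by rewrite /A; field; rewrite gt_eqF.
  have -> : L ^+ 2 / (A + B) = (A + B) ^+ 2 * (A + B) * L ^+ 2 / (A + B) ^+ 4.
    by field; rewrite gt_eqF.
  rewrite ler_wpM2r ?invr_ge0 ?exprn_ge0 ?(ltW D0)//.
  apply: ler_pM => //; [exact: mulr_ge0|exact: sqr_ge0|].
  by apply: ler_pM => //; rewrite lerDr.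
have dy : (- (A * (2 * L ^+ 2 * p.2)) / (A + B) ^+ 2) ^+ 2 <= L ^+ 2 / (A + B).
  have -> : (- (A * (2 * L ^+ 2 * p.2)) / (A + B) ^+ 2) ^+ 2 =
            4 * (A * (L ^+ 2 * p.2 ^+ 2)) * A * L ^+ 2 / (A + B) ^+ 4.
    by field; rewrite gt_eqF.
  have -> : L ^+ 2 / (A + B) = (A + B) ^+ 2 * (A + B) * L ^+ 2 / (A + B) ^+ 4.
    by field; rewrite gt_eqF.
  rewrite ler_wpM2r ?invr_ge0 ?exprn_ge0 ?(ltW D0)//.
  rewrite ler_wpM2r ?sqr_ge0//.
  apply: ler_pM; rewrite ?lerDl//; first by rewrite mulr_ge0// mulr_ge0.
  by apply: le_trans AB; rewrite ler_wpM2l// ler_wpM2l.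
lra.
Qed.

Lemma competitor_ge0 L p : 0 < L -> 0 <= competitor L p.
Proof. by move=> L0; rewrite divr_ge0 ?sqr_ge0// ltW// competitor_den_gt0. Qed.

Lemma envelope_ge0 L p : 0 < L -> 0 <= envelope L p.
Proof. by move=> L0; rewrite divr_ge0 ?sqr_ge0// ltW// competitor_den_gt0. Qed.

Lemma competitor_le1 L p : 0 < L -> competitor L p <= 1.
Proof.
move=> L0; rewrite ler_pdivrMr ?competitor_den_gt0// mul1r /competitor_den lerDl.
by rewrite mulr_ge0 ?sqr_ge0// addr_ge0// sqr_ge0.
Qed.

(** Only the square-integrability of the competitor for each fixed T depends
    on this bound, so the factor L^2 is harmless. *)
Lemma competitor_sqr_le L p : 0 < L -> 0 <= p.1 <= L ->
  competitor L p ^+ 2 <= L ^+ 2 * envelope L p.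
Proof.
move=> L0 /andP[p0 pL]; apply: (@le_trans _ _ (competitor L p)).
  by rewrite expr2 ler_piMl ?competitor_ge0 ?competitor_le1.
rewrite mulrA ler_wpM2r ?invr_ge0 ?(ltW (competitor_den_gt0 p L0))//.
rewrite -[leRHS]expr2 lerXn2r ?nnegrE ?sqr_ge0//.
  by rewrite mulr_ge0// subr_ge0.
by rewrite /parabola; nra.
Qed.

Lemma sub1_competitor_trace L x : 0 < L ->
  1 - competitor L (x, 0) = envelope L (x, 0).
Proof.
move=> L0; have := competitor_den_gt0 (x, 0) L0.
rewrite /competitor /envelope /competitor_den/= expr0n/= addr0 mulr1 => D0.
by field; rewrite gt_eqF.
Qed.

End Competitor.

(** * Integrals over the half-strip and over its horizontal slices *)

Section Energy.
Context {R : realType}.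
Notation mu := (@lebesgue_measure R).
Notation mu2 := (mu \x mu)%E.
Implicit Types (L s T x y c : R).

(** For x <= L / 2 one has L - x >= L / 2, hence D >= L^2 (1 + y^2 + (x/2)^2);
    the constant 3 comes from the Cauchy-Schwarz inequality for three
    terms. *)
Lemma envelope_near L x y : 0 < L -> 0 <= x <= L / 2 -> 0 <= y ->
  envelope L (x, y) <= 3 / (1 + y + x / 2) ^+ 2.
Proof.
move=> L0 /andP[x0 xL] y0; have D0 := competitor_den_gt0 (x, y) L0.
rewrite /envelope ler_pdivrMr// mulrAC ler_pdivlMr ?exprn_gt0//; last by lra.
have qL : (L * (x / 2)) ^+ 2 <= parabola L x ^+ 2.
  by rewrite lerXn2r ?nnegrE /parabola; nra.
have cs : (1 + y + x / 2) ^+ 2 <= 3 * ((x / 2) ^+ 2 + (1 + y ^+ 2)).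
  have := sqr_ge0 (1 - y); have := sqr_ge0 (1 - x / 2).
  by have := sqr_ge0 (y - x / 2); nra.
have := ler_wpM2l (sqr_ge0 L) cs.
by rewrite /competitor_den/=; nra.
Qed.

(** The right half of the segment is the mirror image of the left one. *)
Lemma envelope_le L x y : 0 < L -> 0 <= x <= L -> 0 <= y ->
  envelope L (x, y) <=
  3 / (1 + y + x / 2) ^+ 2 + 3 / (1 + y + (L - x) / 2) ^+ 2.
Proof.
move=> L0 /andP[x0 xL] y0.
have pos t : 0 <= 3 / (t : R) ^+ 2 by rewrite divr_ge0// sqr_ge0.
have [xh|xh] := leP x (L / 2).
  by rewrite (le_trans (envelope_near L0 _ y0)) ?x0 ?lerDl.
have -> : envelope L (x, y) = envelope L (L - x, y).
  by rewrite /envelope /competitor_den /parabola /=; congr (_ / (_ ^+ 2 + _)); ring.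
rewrite (le_trans (envelope_near L0 _ y0)) ?lerDr//.
by apply/andP; split; lra.
Qed.

Lemma is_derive_affine_inv (a b x : R) : a + b * x != 0 ->
  is_derive x 1 (fun t => (a + b * t)^-1) (- b / (a + b * x) ^+ 2).
Proof.
move=> n0.
have n0' : (cst a + b \*: id) x != 0 by [].
have h := is_deriveV n0'
  (is_deriveD (is_derive_cst a x 1) (is_deriveZ b (is_derive_id x 1))).
apply: is_derive_eq h _.
by rewrite -[LHS]/(- (a + b * x) ^- 2 * (0 + b * 1)); field.
Qed.

Lemma continuous_envelope_bound c L : 0 < c -> 0 < L ->
  {within `[0, L], continuous
    (fun x => 3 / (c + x / 2) ^+ 2 + 3 / (c + (L - x) / 2) ^+ 2)}.
Proof.
move=> c0 L0.
apply: continuous_in_subspaceT => x; rewrite inE/= in_itv/= => /andP[x0 xL].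
  have n3 : c + x / 2 != 0 by rewrite gt_eqF//; lra.
  have n4 : c + (L - x) / 2 != 0 by rewrite gt_eqF//; lra.
  have ct : {for x, continuous (fun t : R => c + t / 2)}.
    by apply: cvgD; [exact: cvg_cst|apply: cvgMl; exact: cvg_id].
  have cL : {for x, continuous (fun t : R => c + (L - t) / 2)}.
    apply: cvgD; [exact: cvg_cst|apply: cvgMl].
    by apply: cvgB; [exact: cvg_cst|exact: cvg_id].
  apply: cvgD; apply: cvgMr; apply: cvgV; rewrite ?expf_neq0//.
    exact: (cvgM ct ct).
  exact: (cvgM cL cL).
Qed.

(** Integrating both terms exactly produces the factor L / (c (c + L / 2)),
    which is of order 1 / c for c <= L but decays like L / c^2 for large c;
    the second regime makes the energy of the half-strip finite. *)
Lemma integral_envelope_slice_bound c L : 0 < c -> 0 < L ->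
  (\int[mu]_(x in `[0%R, L])
    (3 / (c + x / 2) ^+ 2 + 3 / (c + (L - x) / 2) ^+ 2)%:E =
  (6 * L / (c * (c + L / 2)))%:E)%E.
Proof.
move=> c0 L0.
pose g x := 6 * ((c + L / 2) + - 2^-1 * x)^-1 - 6 * (c + 2^-1 * x)^-1.
pose dg x := 3 / (c + x / 2) ^+ 2 + 3 / (c + (L - x) / 2) ^+ 2.
have ig x : 0 <= x <= L -> is_derive x 1 g (dg x).
  move=> /andP[x0 xL].
  have n1 : c + L / 2 + - 2^-1 * x != 0 by rewrite gt_eqF//; lra.
  have n2 : c + 2^-1 * x != 0 by rewrite gt_eqF//; lra.
  have n3 : c + x / 2 != 0 by rewrite gt_eqF//; lra.
  have n4 : c + (L - x) / 2 != 0 by rewrite gt_eqF//; lra.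
  have h := is_deriveB (is_deriveZ 6 (is_derive_affine_inv n1))
    (is_deriveZ 6 (is_derive_affine_inv n2)).
  apply: is_derive_eq h _; rewrite /dg /GRing.scale/=.
  have -> : c + L / 2 + - 2^-1 * x = c + (L - x) / 2 by field.
  have -> : c + 2^-1 * x = c + x / 2 by field.
  by field; do ?[apply/andP; split]; rewrite gt_eqF//; lra.
rewrite (@FTC_is_derive R g dg)//.
- congr EFin; rewrite /g; field.
  by do ?[apply/andP; split]; rewrite gt_eqF//; lra.
- exact: continuous_envelope_bound.
Qed.

Lemma integral_envelope_slice L y : 0 < L -> 0 <= y ->
  (\int[mu]_(x in `[0%R, L]) (envelope L (x, y))%:E <=
   (6 * L / ((1 + y) * (1 + y + L / 2)))%:E)%E.
Proof.
move=> L0 y0; rewrite -integral_envelope_slice_bound//; last by lra.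
apply: ge0_le_integral => //=.
- by move=> x _; rewrite lee_fin envelope_ge0.
- apply/measurable_EFinP; apply: measurable_funTS.
  apply: continuous_measurable_fun.
  exact: (continuous_slice1 (continuous_envelope L0)).
- apply/measurable_EFinP; apply: subspace_continuous_measurable_fun => //.
  by apply: continuous_envelope_bound => //; lra.
- move=> x; rewrite in_itv/= => xL; rewrite lee_fin; exact: envelope_le.
Qed.

(** Tonelli on the half-strip, with the integral over y outside. *)
Lemma integral_Omega (T : R) (h : R * R -> R) :
  measurable_fun setT h -> (forall p, 0 <= h p) ->
  (\int[mu2]_(p in Omega T) (h p)%:E =
   \int[mu]_(y in `[0%R, +oo[) \int[mu]_(x in `[0%R, (T / 2)%R]) (h (x, y))%:E)%E.
Proof.
move=> mh h0; rewrite integral_mkcond fubini_tonelli2/=; last 2 first.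
- apply/(measurable_restrictT _ (measurable_Omega T)).
  by apply/measurable_EFinP; exact: measurable_funTS.
- by move=> p; apply: erestrict_ge0 => q _; rewrite lee_fin.
rewrite [RHS]integral_mkcond; apply: eq_integral => y _.
rewrite /fubini_G patchE; case: ifPn => [/[!inE]/= yin|].
  rewrite [RHS]integral_mkcond; apply: eq_integral => x _.
  rewrite !patchE; congr (if _ then _ else _); apply/idP/idP.
    by rewrite !inE /= in_itv/= => -[].
  rewrite !inE /= in_itv/= => ?; split => //=.
  by move: yin; rewrite in_itv/= andbT.
rewrite notin_setE => ny; apply: integral0_eq => x _.
rewrite patchE; case: ifPn => //; rewrite inE => -[_ /= y0].
by exfalso; apply: ny; rewrite /= in_itv/= y0.
Qed.

Lemma measurable_integral_slice (L : R) (h : R * R -> R) :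
  measurable_fun setT h -> (forall p, 0 <= h p) ->
  measurable_fun setT (fun y => \int[mu]_(x in `[0%R, L]) (h (x, y))%:E)%E.
Proof.
move=> mh h0; pose S : set (R * R) := `[0, L] `*` setT.
have mS : measurable S by exact: measurableX.
have mhS : measurable_fun setT ((EFin \o h) \_ S).
  apply/(measurable_restrictT _ mS).
  by apply/measurable_EFinP; exact: measurable_funTS.
have := @measurable_fun_fubini_tonelli_G _ _ _ _ R mu _ mhS.
rewrite (_ : fubini_G _ _ = (fun y => \int[mu]_(x in `[0%R, L]) (h (x, y))%:E)%E).
  by apply => p; apply: erestrict_ge0 => q _; rewrite lee_fin.
apply/funext => y; rewrite /fubini_G [RHS]integral_mkcond.
apply: eq_integral => x _; rewrite !patchE.
by congr (if _ then _ else _); apply/idP/idP; rewrite !inE //= => -[].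
Qed.

End Energy.

(** * Integrals of powers *)

Section PowerIntegrals.
Context {R : realType}.
Notation mu := (@lebesgue_measure R).
Implicit Types (L M p a y : R).

Lemma is_derive_powR_primitive p y : p + 1 != 0 -> 0 < y ->
  is_derive y 1 (fun t => t `^ (p + 1) / (p + 1)) (y `^ p).
Proof.
move=> p1 y0.
have h := is_deriveM (is_derive1_powR (p + 1) y0) (is_derive_cst (p + 1)^-1 y 1).
apply: is_derive_eq h _; rewrite scaler0 add0r /cst/=.
by rewrite /GRing.scale/= addrK mulrA mulVf// mul1r.
Qed.

Lemma continuous_powR_gt0 p y : 0 < y -> {for y, continuous (fun t => t `^ p)}.
Proof. by move=> y0; exact: (is_derive_continuous (is_derive1_powR p y0)). Qed.

Lemma within_continuous_powR p (i : interval R) :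
  (forall y, y \in i -> 0 < y) -> {within [set` i], continuous (fun t => t `^ p)}.
Proof.
move=> i0; apply: continuous_in_subspaceT => y /[!inE]/= /i0.
exact: continuous_powR_gt0.
Qed.

Lemma powR_cvgy0 p : p < 0 -> y `^ p @[y --> +oo] --> 0.
Proof.
move=> p0; apply/cvgrPdist_le => e e0; near=> y.
have p0' : 0 < - p by rewrite oppr_gt0.
rewrite sub0r normrN ger0_norm ?powR_ge0// -[p]opprK powRN.
rewrite -[e]invrK lef_pV2 ?posrE ?invr_gt0 ?powR_gt0//.
have -> : e^-1 = ((e^-1) `^ (- p)^-1) `^ (- p).
  by rewrite -powRrM mulVf ?gt_eqF// powRr1// invr_ge0 ltW.
apply: ge0_ler_powR; rewrite ?nnegrE ?powR_ge0 ?(ltW p0')//.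
Unshelve. all: by end_near. Qed.

(** The fundamental theorem of calculus applies on segments away from 0, on
    which powers with any real exponent are smooth. *)
Lemma integral_powR_segment p a M : 0 < a -> a < M -> p + 1 != 0 ->
  (\int[mu]_(y in `[a, M]) (y `^ p)%:E =
   (M `^ (p + 1) / (p + 1) - a `^ (p + 1) / (p + 1))%:E)%E.
Proof.
move=> a0 aM p1.
apply: (@FTC_is_derive R (fun t => t `^ (p + 1) / (p + 1)) (@powR R ^~ p)) => //.
  by apply: within_continuous_powR => y /[!in_itv]/= /andP[/(lt_le_trans a0)].
by move=> y /andP[ay _]; apply: is_derive_powR_primitive; rewrite ?(lt_le_trans a0).
Qed.

Lemma integral_inv_segment M : 1 < M ->
  (\int[mu]_(y in `[1%R, M]) (y `^ (- 1))%:E = (ln M)%:E)%E.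
Proof.
move=> M1; rewrite -[ln M]subr0 -ln1.
apply: (@FTC_is_derive R (@ln R) (@powR R ^~ (- 1))) => //.
  by apply: within_continuous_powR => y /[!in_itv]/= /andP[/(lt_le_trans ltr01)].
move=> y /andP[y1 _]; have y0 : 0 < y by rewrite (lt_le_trans ltr01).
by rewrite powR_inv1 ?ltW//; exact: is_derive1_ln.
Qed.

Lemma integral_powR_tail p M : 0 < M -> p + 1 < 0 ->
  (\int[mu]_(y in `[M, +oo[) (y `^ p)%:E = (M `^ (p + 1) / - (p + 1))%:E)%E.
Proof.
move=> M0 p1; have p10 : p + 1 != 0 by rewrite lt_eqF.
pose F t := t `^ (p + 1) / (p + 1).
have dF y : M <= y -> is_derive y 1 F (y `^ p).
  by move=> My; apply: is_derive_powR_primitive => //; exact: lt_le_trans My.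
rewrite (@ge0_continuous_FTC2y _ _ F _ 0)/=.
- by rewrite -EFinB sub0r invrN mulrN.
- by move=> y _; exact: powR_ge0.
- by apply: within_continuous_powR => y /[!in_itv]/= /andP[/(lt_le_trans M0)].
- by rewrite -[0](mul0r (p + 1)^-1); apply: cvgMl; exact: powR_cvgy0.
- by move=> y /ltW/dF /@ex_derive.
- by apply: cvg_at_right_filter; exact: (is_derive_continuous (dF _ (lexx M))).
- by move=> y /[!in_itv]/= /andP[/ltW/dF dy _]; rewrite derive1E; exact: derive_val.
Qed.

(** The integrand may blow up at 0, so ]0, 1] is exhausted by the segments
    [1 / (n + 2), 1], on which the integral stays below the bound. *)
Lemma integral_powR_head p : -1 < p ->
  (\int[mu]_(y in `]0%R, 1%R]) (y `^ p)%:E <= ((p + 1)^-1)%:E)%E.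
Proof.
move=> p1; have p0 : 0 < p + 1 by lra.
(* n + 2 rather than n + 1 keeps every segment nondegenerate. *)
pose I (n : nat) : set R := `[n.+2%:R^-1, 1]%classic.
have I0 (n : nat) : 0 < n.+2%:R^-1 :> R by [].
have -> : `]0, 1]%classic = \bigcup_n I n.
  apply/seteqP; split => [y|y [n _]]; rewrite /I /= !in_itv/=; last first.
    by move=> /andP[ny ->]; rewrite (lt_le_trans (I0 n)).
  move=> /andP[y0 y1]; exists (Num.bound y^-1) => //=; rewrite in_itv/= y1 andbT.
  rewrite -[leRHS]invrK lef_pV2 ?posrE ?invr_gt0//.
  have /archi_boundP/ltW yb : 0 <= y^-1 by rewrite invr_ge0 ltW.
  by rewrite (le_trans yb)// ler_nat -addn2 leq_addr.
have cvI : (\int[mu]_(y in I n) (y `^ p)%:E @[n --> \oo] -->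
    \int[mu]_(y in \bigcup_n I n) (y `^ p)%:E)%E.
  apply: ge0_nondecreasing_set_cvg_integral.
  - move=> m n mn; apply/subsetPset => y; rewrite /I /= !in_itv/= => /andP[my ->].
    by rewrite andbT (le_trans _ my)// lef_pV2 ?posrE// ler_nat.
  - by move=> n; exact: measurable_itv.
  - move=> n; apply/measurable_EFinP; apply: measurable_funTS.
    exact: measurable_powR.
  - by move=> n y _; rewrite lee_fin powR_ge0.
rewrite -(cvg_lim _ cvI)//; apply: lime_le.
  by apply/cvg_ex; eexists; exact: cvI.
apply: nearW => n; rewrite integral_powR_segment ?gt_eqF//.
  rewrite lee_fin powR1 div1r gerBl// divr_ge0 ?powR_ge0// ltW//.
by rewrite invf_lt1// ltr1n.
Qed.

End PowerIntegrals.

(** * Growth of the weighted energy *)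

Section EnergyGrowth.
Context {R : realType}.
Notation mu := (@lebesgue_measure R).
Notation mu2 := (mu \x mu)%E.
Implicit Types (L s T x y c : R).

Lemma measurable_weight s : measurable_fun setT (@weight R s).
Proof.
by apply: (@measurableT_comp _ _ _ _ _ _ (@powR R ^~ (1 - 2 * s))) => //;
  exact: measurable_powR.
Qed.

Lemma measurable_weighted s (f : R * R -> R) :
  continuous f -> measurable_fun setT (fun p => weight s p * f p).
Proof.
move=> cf; apply: measurable_funM; first exact: measurable_weight.
exact: continuous_measurable_plane.
Qed.

Lemma weighted_envelope_slice s L y : 0 < L -> 0 <= y ->
  (\int[mu]_(x in `[0%R, L]) (weight s (x, y) * envelope L (x, y))%:E <=
   (y `^ (1 - 2 * s) * (6 * L / ((1 + y) * (1 + y + L / 2))))%:E)%E.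
Proof.
move=> L0 y0; rewrite /weight/=.
under eq_integral do rewrite EFinM.
rewrite ge0_integralZl_EFin ?powR_ge0//; last 2 first.
- by move=> x _; rewrite lee_fin envelope_ge0.
- apply/measurable_EFinP; apply: measurable_funTS.
  apply: continuous_measurable_fun.
  exact: (continuous_slice1 (continuous_envelope L0)).
by rewrite EFinM lee_wpmul2l ?lee_fin ?powR_ge0// integral_envelope_slice.
Qed.

Lemma integral_le_powR (D : set R) (G : R -> \bar R) (k p : R) :
  measurable D -> measurable_fun D G -> 0 <= k ->
  (forall y, 0 <= G y)%E -> (forall y, D y -> G y <= (k * y `^ p)%:E)%E ->
  (\int[mu]_(y in D) G y <= k%:E * \int[mu]_(y in D) (y `^ p)%:E)%E.
Proof.
move=> mD mG k0 G0 Gk.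
have mp : measurable_fun D (fun y => (y `^ p)%:E).
  by apply/measurable_EFinP; apply: measurable_funTS; exact: measurable_powR.
rewrite -ge0_integralZl_EFin//; last by move=> y _; rewrite lee_fin powR_ge0.
apply: ge0_le_integral => //; exact: measurable_funeM.
Qed.

(** These two factorizations turn the slice bounds 12 / y and 6 L / y^2,
    multiplied by the weight, into multiples of powers of y. *)
Lemma powR_split1 y s : 0 < y -> y `^ (1 - 2 * s) = y * y `^ (- (2 * s)).
Proof.
by move=> y0; rewrite -{2}(powRr1 (ltW y0)) -powRD// (gt_eqF y0) implybT.
Qed.

Lemma powR_split2 y s : 0 < y ->
  y `^ (1 - 2 * s) = y ^+ 2 * y `^ (- (2 * s) - 1).
Proof.
move=> y0; rewrite -powR_mulrn ?ltW// -powRD ?(gt_eqF y0) ?implybT//.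
by congr (_ `^ _); ring.
Qed.

(** The three terms are the contributions of y <= 1, 1 < y <= L and y > L,
    where the slice integral is at most 12, 12 / y and 6 L / y^2. *)
Lemma weighted_envelope_le s T : 0 < s -> s < 1 -> 2 < T ->
  (\int[mu2]_(p in Omega T) (weight s p * envelope (T / 2) p)%:E <=
   12%:E * ((1 - 2 * s + 1)^-1)%:E +
   (12%:E * \int[mu]_(y in `[1%R, (T / 2)%R]) (y `^ (- (2 * s)))%:E +
    (3 / s * (T / 2) `^ (1 - 2 * s))%:E))%E.
Proof.
move=> s0 s1 T2; set L := T / 2; have L1 : 1 < L by rewrite /L; lra.
have L0 : 0 < L by rewrite (lt_trans ltr01).
have mh := @measurable_weighted s _ (continuous_envelope L0).
have h0 p : 0 <= weight s p * envelope L p.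
  by rewrite mulr_ge0 ?powR_ge0 ?envelope_ge0.
rewrite integral_Omega// -/L; set G := fun y : R => (\int[_]_(x in _) _)%E.
have mG : measurable_fun setT G by exact: (measurable_integral_slice L mh h0).
have G0 y : (0 <= G y)%E by apply: integral_ge0 => x _; rewrite lee_fin.
have slice y : 0 < y ->
    (G y <= (y `^ (1 - 2 * s) * (6 * L / ((1 + y) * (1 + y + L / 2))))%:E)%E.
  by move=> /ltW; exact: weighted_envelope_slice.
rewrite -integral_itv_obnd_cbnd; last exact: measurable_funTS.
have -> : `]0, +oo[%classic =
    `]0, 1]%classic `|` (`]1, L]%classic `|` `]L, +oo[%classic) :> set R.
  apply/seteqP; split => y /=; rewrite !in_itv/= !andbT.
    move=> y0; have [y1|y1] := leP y 1; first by left; rewrite y0.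
    by right; have [yL|yL] := leP y L; [left|right].
  by move=> [/andP[//]|[/andP[/(lt_trans ltr01)//]|/(lt_trans L0)]].
rewrite ge0_integral_setU//; first last.
- rewrite disj_set2E; apply/eqP/seteqP; split => // y [] /=; rewrite !in_itv/= !andbT.
  by move=> /andP[_ y1] [/andP[]|]; lra.
- by move=> y _; exact: G0.
- exact: measurable_funTS.
- exact: measurableU.
rewrite ge0_integral_setU//; first last.
- rewrite disj_set2E; apply/eqP/seteqP; split => // y [] /=; rewrite !in_itv/= !andbT.
  by move=> /andP[_ y1]; lra.
- by move=> y _; exact: G0.
- exact: measurable_funTS.
apply: leeD; last apply: leeD.
- apply: le_trans (lee_wpmul2l _ (integral_powR_head _)); last 2 first.
  + by rewrite lee_fin.
  + lra.
  apply: integral_le_powR => //; first exact: measurable_funTS.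
  move=> y /=; rewrite in_itv/= => /andP[y0 y1].
  apply: le_trans (slice _ y0) _; rewrite lee_fin mulrC ler_wpM2r ?powR_ge0//.
  by rewrite ler_pdivrMr; nra.
- have -> : (\int[mu]_(y in `[1%R, L]) (y `^ (- (2 * s)))%:E =
             \int[mu]_(y in `]1%R, L]) (y `^ (- (2 * s)))%:E)%E.
    rewrite integral_itv_obnd_cbnd//.
    by apply/measurable_EFinP; apply: measurable_funTS; exact: measurable_powR.
  apply: integral_le_powR => //; first exact: measurable_funTS.
  move=> y /=; rewrite in_itv/= => /andP[/(lt_trans ltr01) y0 yL].
  apply: le_trans (slice _ y0) _.
  rewrite lee_fin powR_split1// mulrAC ler_wpM2r ?powR_ge0//.
  by rewrite mulrA ler_pdivrMr; nra.
- have -> : 3 / s * L `^ (1 - 2 * s) =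
      6 * L * (L `^ (- (2 * s) - 1 + 1) / - (- (2 * s) - 1 + 1)).
    rewrite powR_split1// subrK opprK.
    by field; rewrite gt_eqF.
  rewrite [leRHS]EFinM -integral_powR_tail//; last by lra.
  rewrite -[in leRHS]integral_itv_obnd_cbnd; last first.
    by apply/measurable_EFinP; apply: measurable_funTS; exact: measurable_powR.
  apply: integral_le_powR => //; first exact: measurable_funTS.
    by rewrite mulr_ge0// ltW.
  move=> y /=; rewrite in_itv/= andbT => /(lt_trans L0) y0.
  apply: le_trans (slice _ y0) _.
  rewrite lee_fin powR_split2// mulrAC ler_wpM2r ?powR_ge0//.
  rewrite mulrA ler_pdivrMr; nra.
Qed.

(** The claimed rate, without its constant, in the three regimes of s. *)
Definition growth s T : R :=
  if s < 1 / 2 then T `^ (1 - 2 * s) else if s == 1 / 2 then ln T else 1.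

(** This lets bounded contributions be absorbed in the rate; the threshold
    expR 1 is chosen for ln T >= 1. *)
Lemma growth_ge1 s T : expR 1 < T -> 1 <= growth s T.
Proof.
move=> eT; have e2 : 2 <= expR 1 :> R by have := @expR_ge1Dx R 1; lra.
have T0 : 0 < T by lra.
rewrite /growth; case: ifP => [sh|_].
  by rewrite -[leLHS](powRr0 T) ler_powR; lra.
case: ifP => // _; rewrite -[leLHS]expRK ler_ln ?posrE ?expR_gt0// ltW//.
Qed.

(** The middle term of [weighted_envelope_le] decides the regime: the integral
    of y^(- 2 s) over [1, L] is of order L^(1 - 2 s), ln L or 1 according to
    whether s is less than, equal to or greater than 1 / 2. *)
Lemma weighted_envelope_growth s : 0 < s -> s < 1 ->
  exists2 C : R, 0 <= C & forall T, expR 1 < T ->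
  (\int[mu2]_(p in Omega T) (weight s p * envelope (T / 2) p)%:E <=
    (C * growth s T)%:E)%E.
Proof.
move=> s0 s1.
suff [C C0 HC] : exists2 C : R, 0 <= C & forall T, 2 < T -> expR 1 < T ->
    (12%:E * \int[mu]_(y in `[1%R, (T / 2)%R]) (y `^ (- (2 * s)))%:E +
    (3 / s * (T / 2) `^ (1 - 2 * s))%:E <= (C * growth s T)%:E)%E.
  have K0 : 0 <= 12 * (1 - 2 * s + 1)^-1 :> R by rewrite mulr_ge0// invr_ge0; lra.
  exists (12 * (1 - 2 * s + 1)^-1 + C) => [|T eT]; first by rewrite addr_ge0.
  have T2 : 2 < T by apply: le_lt_trans eT; have := @expR_ge1Dx R 1; lra.
  apply: (le_trans (weighted_envelope_le s0 s1 T2)).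
  rewrite [(_ + C) * _]mulrDl [leRHS]EFinD; apply: leeD; last exact: HC.
  by rewrite -EFinM lee_fin ler_peMr// growth_ge1.
have [sh|sh|sh] := ltgtP s (1 / 2).
- have a0 : 0 < 1 - 2 * s by lra.
  exists (12 / (1 - 2 * s) + 3 / s) => [|T T2 eT].
    by rewrite addr_ge0// divr_ge0// ltW.
  rewrite integral_powR_segment ?gt_eqF//; [|lra..].
  rewrite -EFinM -EFinD lee_fin /growth sh powR1 [(_ + 3 / s) * _]mulrDl.
  have TT : (T / 2) `^ (1 - 2 * s) <= T `^ (1 - 2 * s).
    by apply: ge0_ler_powR; rewrite ?nnegrE; lra.
  have -> : - (2 * s) + 1 = 1 - 2 * s by rewrite addrC.
  apply: lerD; last by rewrite ler_wpM2l// divr_ge0// ltW.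
  rewrite -mulrA ler_wpM2l// -mulrBl mulrC ler_wpM2l ?invr_ge0 ?(ltW a0)//; lra.
- exists (3 / s + 12 / (2 * s - 1)) => [|T T2 eT].
    by rewrite addr_ge0// divr_ge0//; lra.
  rewrite integral_powR_segment ?lt_eqF//; [|lra..].
  rewrite -EFinM -EFinD lee_fin /growth ltNge (ltW sh)/= gt_eqF// mulr1 powR1.
  have -> : - (2 * s) + 1 = 1 - 2 * s by rewrite addrC.
  have T1 : (T / 2) `^ (1 - 2 * s) <= 1.
    by rewrite -[leRHS](powRr0 (T / 2)) ler_powR; lra.
  have P0 := powR_ge0 (T / 2) (1 - 2 * s).
  move: ((T / 2) `^ (1 - 2 * s)) P0 T1 => P P0 P1.
  rewrite addrC; apply: lerD; first by rewrite ler_piMr// divr_ge0// ltW.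
  rewrite ler_wpM2l// -mulrBl -[leRHS]mul1r -[1 - 2 * s]opprB invrN mulrN -mulNr.
  by rewrite ler_wpM2r ?invr_ge0; lra.
- exists (12 + 3 / s) => [|T T2 eT]; first by rewrite addr_ge0// divr_ge0// ltW.
  rewrite sh (_ : - (2 * (1 / 2)) = -1); last by field.
  rewrite integral_inv_segment; last by lra.
  rewrite subrr powRr0 -EFinM -EFinD lee_fin [(_ + 3 / (1 / 2)) * _]mulrDl -sh.
  have lnT : 1 <= growth s T by exact: growth_ge1.
  apply: lerD; last by rewrite ler_wpM2l// divr_ge0// ltW.
  rewrite ler_wpM2l// /growth sh ltxx eqxx.
  by rewrite ler_ln ?posrE; lra.
Qed.

End EnergyGrowth.

(** * Admissibility of the competitor and its energy *)

Section Admissible.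
Context {R : realType}.
Notation mu := (@lebesgue_measure R).
Notation mu2 := (mu \x mu)%E.
Implicit Types (L s T x y c : R) (F : R -> R).

Lemma competitor_weak_gradient T : 0 < T ->
  is_weak_gradient T (competitor (T / 2))
    (fun p => (competitor_dx (T / 2) p, competitor_dy (T / 2) p)).
Proof.
move=> T0; have L0 : 0 < T / 2 by rewrite divr_gt0.
apply: is_weak_gradient_C1.
- exact: continuous_competitor.
- exact: continuous_competitor_dx.
- exact: continuous_competitor_dy.
- by move=> x y; exact: is_derive_competitor_dx.
- by move=> x y; exact: is_derive_competitor_dy.
Qed.

(** The density is at most (L^2 + 2) y^(1 - 2 s) E, which is integrable. *)
Lemma competitor_weighted_H1 s T : 0 < s -> s < 1 -> expR 1 < T ->
  weighted_H1 s T (competitor (T / 2)).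
Proof.
move=> s0 s1 eT; have T0 : 0 < T by rewrite (lt_trans _ eT) ?expR_gt0.
have L0 : 0 < T / 2 by rewrite divr_gt0.
split.
  apply: measurable_funTS; apply: continuous_measurable_plane.
  exact: continuous_competitor.
exists (fun p => (competitor_dx (T / 2) p, competitor_dy (T / 2) p)).
  exact: competitor_weak_gradient.
have [C _ HC] := weighted_envelope_growth s0 s1.
have iE : mu2.-integrable (Omega T)
    (fun p => (weight s p * envelope (T / 2) p)%:E).
  apply/integrableP; split.
    apply/measurable_EFinP; apply: measurable_funTS.
    exact: measurable_weighted (continuous_envelope L0).
  apply: le_lt_trans (ltry (C * growth s T)); apply: le_trans (HC _ eT).
  rewrite le_eqVlt; apply/orP; left; apply/eqP; apply: eq_integral => p _.
  by rewrite gee0_abs// lee_fin mulr_ge0 ?powR_ge0 ?envelope_ge0.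
have iE2 : mu2.-integrable (Omega T) (fun p =>
    ((T / 2) ^+ 2 + 2)%:E * (weight s p * envelope (T / 2) p)%:E)%E.
  by apply: integrableZl => //; exact: measurable_Omega.
apply: le_integrable iE2; first exact: measurable_Omega.
  apply/measurable_EFinP; apply: measurable_funTS; apply: measurable_weighted.
  have cV := continuous_sqr (continuous_competitor L0).
  have cx := continuous_sqr (continuous_competitor_dx L0).
  have cy := continuous_sqr (continuous_competitor_dy L0).
  by move=> p; apply: cvgD; [exact: cV|apply: cvgD; [exact: cx|exact: cy]].
move=> p [p1 _]; have w0 : 0 <= weight s p by exact: powR_ge0.
have E0 := envelope_ge0 p L0.
have N0 : 0 <= normsq (competitor_dx (T / 2) p, competitor_dy (T / 2) p).
  by rewrite addr_ge0// sqr_ge0.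
rewrite -EFinM !abse_EFin lee_fin !ger0_norm; first last.
- by rewrite mulr_ge0// addr_ge0// sqr_ge0.
- by apply: mulr_ge0; [rewrite addr_ge0// sqr_ge0|exact: mulr_ge0].
rewrite mulrCA ler_wpM2l// mulrDl lerD//.
  exact: competitor_sqr_le.
exact: competitor_normsq_le.
Qed.

(** The traces exist along every line, by continuity. *)
Lemma competitor_Lambda s T : 0 < s -> s < 1 -> expR 1 < T ->
  Lambda s T (competitor (T / 2)).
Proof.
move=> s0 s1 eT; have T0 : 0 < T by rewrite (lt_trans _ eT) ?expR_gt0.
have L0 : 0 < T / 2 by rewrite divr_gt0.
have cV := continuous_competitor L0; split.
- exact: competitor_weighted_H1.
- split; apply: aeW.
  + by move=> x _; apply: cvg_at_right_filter; exact: (continuous_slice2 cV).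
  + by move=> y _; apply: cvg_at_right_filter; exact: (continuous_slice1 cV).
  + by move=> y _; apply: cvg_at_left_filter; exact: (continuous_slice1 cV).
- by move=> p _; exact: competitor_ge0.
- by move=> y _; rewrite /competitor /parabola/= mul0r subrr mulr0 expr0n/= !mul0r.
Qed.

(** The mean value theorem on [v, 1], where F(1) = 0; the derivative is bounded
    on [0, 1] by continuity. *)
Lemma double_well_linear_bound F : double_well F ->
  exists2 K : R, 0 <= K & forall v, 0 <= v <= 1 -> F v <= K * (1 - v).
Proof.
move=> [[smF _] [F1 _ _] _ _ _].
have dF (v : R) : is_derive v 1 F (F^`() v)%classic.
  by rewrite derive1E; apply: derivableP; exact: (smF 0%N).
have cF' : continuous (F^`())%classic.
  move=> v; apply: differentiable_continuous; rewrite -derivable1_diffP.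
  exact: (smF 1%N).
have cF : continuous F by move=> v; exact: (is_derive_continuous (dF v)).
have [c _ cmax] := @EVT_max R (fun v => `|(F^`())%classic v|) 0 1 ler01
  (continuous_subspaceT (fun v => continuous_comp (cF' v) (@norm_continuous _ _ _))).
exists (`|(F^`())%classic c|) => // v /andP[v0 v1].
have [z z01] := @MVT_segment R F (F^`())%classic v 1 v1 (fun x _ => dF x)
  (continuous_subspaceT cF).
rewrite F1 sub0r => /eqP; rewrite eqr_oppLR -mulNr => /eqP ->.
rewrite ler_wpM2r ?subr_ge0// (le_trans (ler_norm _))// normrN; apply: cmax.
by move: z01; rewrite !in_itv/= => /andP[/(le_trans v0) -> ->].
Qed.

Lemma double_well_continuous F : double_well F -> continuous F.
Proof.
move=> [[smF _] _ _ _ _] v; apply: differentiable_continuous.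
by rewrite -derivable1_diffP; exact: (smF 0%N).
Qed.

Lemma competitor_potential_integrable F T : 0 < T -> double_well F ->
  potential_integrable F T (competitor (T / 2)).
Proof.
move=> T0 dwF; have L0 : 0 < T / 2 by rewrite divr_gt0.
apply: (@continuous_compact_integrable R (fun x => F (competitor (T / 2) (x, 0)))).
  exact: segment_compact.
apply: continuous_subspaceT => x; apply: continuous_comp.
  exact: (continuous_slice1 (continuous_competitor L0)).
exact: double_well_continuous.
Qed.

(** The slice bound at y = 0 is 6 L / (1 + L / 2), which is below 12
    uniformly in L. *)
Lemma competitor_potential_le F T K : 0 < T -> double_well F -> 0 <= K ->
  (forall v, 0 <= v <= 1 -> F v <= K * (1 - v)) ->
  (\int[mu]_(x in `[0%R, (T / 2)%R]) (F (competitor (T / 2) (x, 0)))%:E <=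
   (12 * K)%:E)%E.
Proof.
move=> T0 dwF K0 FK; set L := T / 2; have L0 : 0 < L by rewrite divr_gt0.
have cE := continuous_slice1 (y := 0) (continuous_envelope L0).
apply: (@le_trans _ _ (\int[mu]_(x in `[0%R, L]) (K%:E * (envelope L (x, 0))%:E))%E).
  apply: le_integral => //.
  - exact: (competitor_potential_integrable T0 dwF).
  - apply: integrableZl => //.
    apply: (@continuous_compact_integrable R (fun x => envelope L (x, 0))).
      exact: segment_compact.
    exact: continuous_subspaceT.
  - move=> x _; rewrite -EFinM lee_fin -sub1_competitor_trace//; apply: FK.
    by rewrite competitor_ge0// competitor_le1.
rewrite ge0_integralZl_EFin//; last 2 first.
- by move=> x _; rewrite lee_fin envelope_ge0.
- apply/measurable_EFinP; apply: measurable_funTS.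
  exact: continuous_measurable_fun.
rewrite mulrC EFinM lee_wpmul2l//.
apply: le_trans (integral_envelope_slice L0 (lexx 0)) _.
rewrite lee_fin addr0 mul1r ler_pdivrMr; lra.
Qed.

Lemma dconst_ge0 s : 0 <= dconst s :> R.
Proof.
rewrite mulr_ge0 ?powR_ge0// divr_ge0// /Gamma Rintegral_ge0// => t _.
  by rewrite mulr_ge0 ?powR_ge0 ?expR_ge0.
by rewrite mulr_ge0 ?powR_ge0 ?expR_ge0.
Qed.

(** The Dirichlet term is an infimum over weak gradients, so the classical
    gradient of the competitor bounds it from above. *)
Lemma competitor_J_le s F : 0 < s -> s < 1 -> double_well F ->
  exists2 C, 0 < C & forall T, expR 1 < T ->
    (J s F T (competitor (T / 2)) <= (C * growth s T)%:E)%E.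
Proof.
move=> s0 s1 dwF; have [K K0 FK] := double_well_linear_bound dwF.
have [C C0 HC] := weighted_envelope_growth s0 s1.
exists (dconst s * C + 12 * K + 1) => [|T eT].
  by rewrite ltr_wpDl// addr_ge0// mulr_ge0// dconst_ge0.
have T0 : 0 < T by rewrite (lt_trans _ eT) ?expR_gt0.
have L0 : 0 < T / 2 by rewrite divr_gt0.
have dir : (dirichlet s T (competitor (T / 2)) <= (2 * (C * growth s T))%:E)%E.
  apply: (@le_trans _ _ (\int[mu2]_(p in Omega T)
      (2%:E * (weight s p * envelope (T / 2) p)%:E))%E); last first.
    rewrite ge0_integralZl_EFin//.
    - by rewrite EFinM lee_wpmul2l ?lee_fin// HC.
    - exact: measurable_Omega.
    - by move=> p _; rewrite lee_fin mulr_ge0 ?powR_ge0 ?envelope_ge0.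
    - apply/measurable_EFinP; apply: measurable_funTS.
      exact: measurable_weighted (continuous_envelope L0).
  apply: le_trans (ereal_inf_lbound (ex_intro2 _ _ _
    (competitor_weak_gradient T0) erefl)) _.
  apply: ge0_le_integral => //.
  - exact: measurable_Omega.
  - move=> p _; rewrite lee_fin mulr_ge0 ?powR_ge0//.
    by rewrite addr_ge0 ?sqr_ge0.
  - apply/measurable_EFinP; apply: measurable_funTS; apply: measurable_weighted.
    have cx := continuous_sqr (continuous_competitor_dx L0).
    have cy := continuous_sqr (continuous_competitor_dy L0).
    by move=> p; apply: cvgD; [exact: cx|exact: cy].
  - apply: measurable_funeM; apply/measurable_EFinP; apply: measurable_funTS.
    exact: measurable_weighted (continuous_envelope L0).
  - move=> p [p1 _]; rewrite -EFinM lee_fin mulrCA ler_wpM2l ?powR_ge0//.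
    exact: competitor_normsq_le.
have g1 := growth_ge1 s eT.
apply: (@le_trans _ _
  ((dconst s / 2)%:E * (2 * (C * growth s T))%:E + (12 * K)%:E)%E).
  apply: leeD; last exact: competitor_potential_le.
  by rewrite lee_wpmul2l// lee_fin divr_ge0// dconst_ge0.
rewrite -EFinM -EFinD lee_fin.
have -> : dconst s / 2 * (2 * (C * growth s T)) = dconst s * C * growth s T by field.
have := mulr_ge0 K0 (ltW (lt_le_trans ltr01 g1)); nra.
Qed.

End Admissible.

Theorem theorem5p1 (R : realType) (s : R) (F : R -> R) :
  0 < s -> s < 1 -> double_well F ->
  exists T1 C : R, [/\ 1 < T1, 0 < C &
    forall T : R, T1 < T ->
    forall u : R -> R,
      odd_periodic_solution s F T u ->
      is_minimizer s F T (harmonic_extension s u) ->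
      [/\ s < 1 / 2 ->
            (J s F T (harmonic_extension s u) <= (C * T `^ (1 - 2 * s))%:E)%E,
          s = 1 / 2 ->
            (J s F T (harmonic_extension s u) <= (C * ln T)%:E)%E &
          1 / 2 < s ->
            (J s F T (harmonic_extension s u) <= C%:E)%E]].
Proof.
move=> s0 s1 dwF; have [C C0 HC] := competitor_J_le s0 s1 dwF.
exists (expR 1), C; split => // [|T eT u _ [_ _ minU]].
  by rewrite -expR0 ltr_expR.
have T0 : 0 < T by rewrite (lt_trans _ eT) ?expR_gt0.
have JU : (J s F T (harmonic_extension s u) <= (C * growth s T)%:E)%E.
  apply: le_trans (HC _ eT); apply: minU; first exact: competitor_Lambda.
  exact: competitor_potential_integrable.
by move: JU; rewrite /growth; split => [sh|sh|sh]; move: JU;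
  [rewrite sh|rewrite sh ltxx eqxx|rewrite ltNge (ltW sh) gt_eqF// mulr1].
Qed.
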